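(* Let $$\mathfrak{a}=\langle x_1^{r_1-1}+x_1^{r_1-2}+\cdots+1,\ \ldots,\ x_n^{r_n-1}+x_n^{r_n-2}+\cdots+1\rangle$$ be an ideal in $\mathbb{Z}[x_1,\ldots,x_n]$, where $r_1,\ldots,r_n\ge 2$ are integers. The residue class polynomial ring $\mathbb{Z}[x_1,\ldots,x_n]/\mathfrak{a}$ is a free and finitely generated $\mathbb{Z}$-module. Let $\mathcal{V}(\mathfrak{a})\subset\mathbb{C}^n$, the set of zeros of $\mathfrak{a}$, be of cardinality $N$. For every $(a_1,\ldots,a_n)\in\mathcal{V}(\mathfrak{a})$ let $\psi$ be the isomorphism $$\psi:\mathbb{Z}[a_1,\ldots,a_n]\to\mathbb{Z}[x_1,\ldots,x_n]/\sqrt{\mathfrak{a}},\qquad \sum_{i=1}^{l}\alpha_i a_1^{i_1}\cdots a_n^{i_n}\mapsto\sum_{i=1}^{l}\alpha_i x_1^{i_1}\cdots x_n^{i_n}+\sqrt{\mathfrak{a}}.$$ Then, for an ideal $\mathfrak{A}$ in $\mathbb{Z}[x_1,\ldots,x_n]/\mathfrak{a}$, $$\mathfrak{a}\text{-}SPP_{\gamma N^2}(\mathfrak{A})\le\mathfrak{a}\text{-}SSub_{\gamma}(\psi^{-1}(\mathfrak{A}))\quad\text{and}\quad \mathfrak{a}\text{-}SSub_{\gamma N^2}(\psi^{-1}(\mathfrak{A}))\le\mathfrak{a}\text{-}SPP_{\gamma}(\mathfrak{A}),$$ where $P\le Q$ means that problem $P$ is polynomial time reducible to problem $Q$.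
   Context: $\sqrt{\mathfrak{a}}$ is the radical of $\mathfrak{a}$; for this $\mathfrak{a}$ one has $\sqrt{\mathfrak{a}}=\mathfrak{a}$, so $\psi$ has target $\mathbb{Z}[x_1,\ldots,x_n]/\mathfrak{a}$. The assertion that $\psi$ is an isomorphism for every $(a_1,\ldots,a_n)\in\mathcal{V}(\mathfrak{a})$ is part of the source's setup. Here $\mathbb{Z}[a_1,\ldots,a_n]$ is the ring generated by $a_1,\ldots,a_n$, and $\psi^{-1}(\mathfrak{A})$ is an ideal of it. For an ideal $I$ of $\mathbb{Z}[a_1,\ldots,a_n]$, $(a_1,\ldots,a_n)\in\mathcal{V}(\mathfrak{a})$, and an element $\alpha=\sum_{i=1}^{l}\alpha_i a_1^{i_1}\cdots a_n^{i_n}$ of $I$ (with $\alpha_i\in\mathbb{Z}$), define $$\mathrm{maxsub}(\alpha)=\max_{1\le j\le N}\Bigl\{\Bigl|\sum_{i=1}^{l}\alpha_i (a_1^{(j)})^{i_1}\cdots (a_n^{(j)})^{i_n}\Bigr| : (a_1^{(j)},\ldots,a_n^{(j)})\in\mathcal{V}(\mathfrak{a})\Bigr\}.$$ Approximate Smallest Substitution Problem $\mathfrak{a}\text{-}SSub_\gamma(I)$: given an ideal $I$ in $\mathbb{Z}[a_1,\ldots,a_n]$, find a nonzero element $\alpha\in I$ such that $\mathrm{maxsub}(\alpha)\le\gamma\,\mathrm{maxsub}(\alpha')$ for all nonzero $\alpha'\in I$. Approximate Shortest Polynomial Problem $\mathfrak{a}\text{-}SPP_\gamma(\mathfrak{A})$: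 given an ideal $\mathfrak{A}\subseteq\mathbb{Z}[x_1,\ldots,x_n]/\mathfrak{a}$, determine $g\in\mathfrak{A}$ with $g\ne0$ and $\|g\|_{\mathfrak{a},\prec}\le\gamma\,\lambda_1^\infty(\mathfrak{A})$. Here $\prec$ is a monomial order with respect to which $\mathbb{Z}[x_1,\ldots,x_n]/\mathfrak{a}$ has a $\mathbb{Z}$-basis of monomials, $\|g\|_{\mathfrak{a},\prec}$ is the maximum absolute value of the coefficients of $g$ reduced modulo $\mathfrak{a}$ with respect to $\prec$, and $\lambda_1^\infty(\mathfrak{A})$ is the minimum distance, in the $\ell_\infty$ norm, of the lattice of coefficient vectors of elements of $\mathfrak{A}$. *)

(* Defs.v *)
From HB Require Import structures.
From mathcomp Require Import all_boot all_order all_algebra.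
From mathcomp Require Import generic_quotient ring_quotient algC.
From mathcomp Require Import boolp classical_sets cardinality reals.
From mathcomp Require Import complex mpoly.

Set Implicit Arguments.
Unset Strict Implicit.
Unset Printing Implicit Defensive.

Import GRing.Theory.
Local Open Scope ring_scope.
Local Open Scope quotient_scope.

(* [idealr] of ring_quotient excludes the improper ideal, which is a
   legitimate instance of the lattice problems below. *)
Record ideal (A : comNzRingType) := Ideal {
  ideal_set :> set A;
  ideal0 : ideal_set 0;
  idealD : forall x y, ideal_set x -> ideal_set y -> ideal_set (x + y);
  idealM : forall c x, ideal_set x -> ideal_set (c * x) }.

Definition generated (A : comNzRingType) (s : seq A) : set A :=
  [set x | exists c : 'I_(size s) -> A, x = \sum_i c i * tnth (in_tuple s) i].

Section Preimage.
Variables (A B : comNzRingType) (f : {rmorphism A -> B}) (J : ideal B).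

Fact preim0 : (f @^-1` J)%classic 0.
Proof. by rewrite /preimage /= rmorph0; exact: ideal0. Qed.
Fact preimD x y : (f @^-1` J)%classic x -> (f @^-1` J)%classic y ->
  (f @^-1` J)%classic (x + y).
Proof. by rewrite /preimage /= rmorphD; exact: idealD. Qed.
Fact preimM c x : (f @^-1` J)%classic x -> (f @^-1` J)%classic (c * x).
Proof. by rewrite /preimage /= rmorphM; exact: idealM. Qed.

Definition preim_ideal : ideal A := Ideal preim0 preimD preimM.
End Preimage.

Definition free_fin_gen (V : zmodType) : Prop :=
  exists (k : nat) (b : 'I_k -> V),
    forall v : V, exists! c : 'rV[int]_k, v = \sum_i b i *~ c 0 i.

Definition cyc_gen n (r : 'I_n -> nat) (i : 'I_n) : {mpoly int[n]} :=
  \sum_(k < r i) 'X_i ^+ k.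

(* [hr] is an argument because the quotient is a nonzero ring only if
   every r i is at least 2. *)
Definition cyc_ideal n (r : 'I_n -> nat) (hr : forall i, (2 <= r i)%N) :
    {pred {mpoly int[n]}} :=
  fun p => `[< generated [seq cyc_gen r i | i <- enum 'I_n] p >].

Section CycIdeal.
Variables (n : nat) (r : 'I_n -> nat) (hr : forall i, (2 <= r i)%N).

Fact cyc_common_zero : exists h : {rmorphism {mpoly int[n]} -> algC},
  forall i, h (cyc_gen r i) = 0.
Proof.
have root_i i : exists z : algC, \sum_(k < r i) z ^+ k = 0.
  pose q : {poly algC} := \poly_(k < r i) 1.
  have sq : size q = r i.
    rewrite size_poly_eq ?oner_eq0 //.
  have /closed_rootP [z /rootP qz] : size q != 1%N.
    by rewrite sq; case: (r i) (hr i) => [|[|]].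
  exists z; rewrite -[RHS]qz horner_poly; apply: eq_bigr => k _.
  by rewrite mul1r.
pose z i := projT1 (cid (root_i i)).
exists (meval z \o map_mpoly intr) => i.
rewrite /cyc_gen rmorph_sum -[RHS](projT2 (cid (root_i i))).
apply: eq_bigr => k _; rewrite rmorphXn /comp; congr (_ ^+ _).
rewrite -[LHS]/((map_mpoly intr (@mpolyX n int U_(i)%MM)).@[z]).
by rewrite map_mpolyX mevalXU.
Qed.

Fact cyc_ideal_closed : idealr_closed (cyc_ideal hr).
Proof.
split.
- apply/asboolP; exists (fun=> 0).
  by rewrite big1 // => i _; rewrite mul0r.
- apply/negP => /asboolP [c].
  have [h h0] := cyc_common_zero.
  move=> /(congr1 h); rewrite rmorph1 raddf_sum big1 => [/eqP|i _].
    by rewrite oner_eq0.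
  have /mapP [j _ ->] :=
    mem_tnth i (in_tuple [seq cyc_gen r i | i <- enum 'I_n]).
  by rewrite [LHS](rmorphM h) h0 mulr0.
- move=> a u v /asboolP [c ->] /asboolP [d ->]; apply/asboolP.
  exists (fun i => a * c i + d i).
  rewrite mulr_sumr -big_split /=; apply: eq_bigr => i _.
  by rewrite mulrDl mulrA.
Qed.

HB.instance Definition _ := isIdealr.Build _ (cyc_ideal hr) cyc_ideal_closed.
End CycIdeal.

Definition cyc_ring n (r : 'I_n -> nat) (hr : forall i, (2 <= r i)%N) :=
  {ideal_quot (cyc_ideal hr)}.
HB.instance Definition _ n r hr := GRing.ComNzRing.on (@cyc_ring n r hr).

Definition residue n (r : 'I_n -> nat) (hr : forall i, (2 <= r i)%N)
  (p : {mpoly int[n]}) : cyc_ring hr := \pi p.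

Definition evalC (R : rcfType) n (a : 'I_n -> R[i]) (p : {mpoly int[n]}) : R[i] :=
  (map_mpoly intr p).@[a].

Definition zeros (R : rcfType) n (I : {pred {mpoly int[n]}}) : set ('I_n -> R[i]) :=
  [set a | forall p, p \in I -> evalC a p = 0].

Definition in_adj (R : rcfType) n (a : 'I_n -> R[i]) : {pred R[i]} :=
  fun z => `[< exists p, evalC a p = z >].

Section Adjunction.
Variables (R : rcfType) (n : nat) (a : 'I_n -> R[i]).

Fact in_adj_subring : subring_closed (in_adj a).
Proof.
split.
- by apply/asboolP; exists 1; rewrite /evalC !rmorph1.
- move=> _ _ /asboolP [p <-] /asboolP [q <-]; apply/asboolP.
  by exists (p - q); rewrite /evalC !rmorphB.
- move=> _ _ /asboolP [p <-] /asboolP [q <-]; apply/asboolP.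
  by exists (p * q); rewrite /evalC !rmorphM.
Qed.

HB.instance Definition _ :=
  GRing.isSubringClosed.Build _ (in_adj a) in_adj_subring.

Record Zadj := ZAdj { Zval : R[i]; Zval_adj : Zval \in in_adj a }.

HB.instance Definition _ := [isSub for Zval].
HB.instance Definition _ := [Choice of Zadj by <:].
HB.instance Definition _ := [SubChoice_isSubComNzRing of Zadj by <:].

Fact evalC_adj p : evalC a p \in in_adj a.
Proof. by apply/asboolP; exists p. Qed.

Definition Zeval (p : {mpoly int[n]}) : Zadj := ZAdj (evalC_adj p).

(* An expression of alpha as an integer polynomial in a_1, ..., a_n. *)
Definition expression (alpha : Zadj) : {mpoly int[n]} :=
  xget 0 [set p | Zeval p = alpha].
End Adjunction.

(* When polynomials that agree at a agree on all of V(I), i.e. under the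
   isomorphism psi, the chosen expression is irrelevant; and V(I) being finite
   and nonempty the supremum is the maximum. *)
Definition maxsub (R : realType) n (I : {pred {mpoly int[n]}})
    (a : 'I_n -> R[i]) (alpha : Zadj a) : R :=
  sup [set Re `|evalC b (expression alpha)| | b in @zeros R n I].

(* Well-foundedness follows from the fields below (Dickson's lemma). *)
Record monomial_order n (le : rel 'X_{1..n}) : Prop := MonomialOrder {
  mo_refl : reflexive le;
  mo_anti : antisymmetric le;
  mo_trans : transitive le;
  mo_total : total le;
  mo_min : forall m, le 0%MM m;
  mo_add : forall m m1 m2, le m1 m2 -> le (m1 + m)%MM (m2 + m)%MM }.

Definition is_lead n (le : rel 'X_{1..n}) (p : {mpoly int[n]}) (m : 'X_{1..n}) :=
  m \in msupp p /\ forall m', m' \in msupp p -> le m' m.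

Definition reduced n (le : rel 'X_{1..n}) (I : {pred {mpoly int[n]}})
    (p : {mpoly int[n]}) : Prop :=
  forall m, m \in msupp p -> ~ exists2 q, q \in I & is_lead le q m.

Section Lattice.
Variables (n : nat) (r : 'I_n -> nat) (hr : forall i, (2 <= r i)%N).
Variable le : rel 'X_{1..n}.
Local Notation A := (cyc_ring hr).

(* The residues of the monomials that are not leading monomials of the ideal
   form a Z-basis of the quotient. *)
Definition monomial_basis : Prop :=
  forall g : A, exists! p, reduced le (cyc_ideal hr) p /\ residue hr p = g.

(* The coefficient vector of g is the family of coefficients of this
   polynomial. *)
Definition normal_form (g : A) : {mpoly int[n]} :=
  xget 0 [set p | reduced le (cyc_ideal hr) p /\ residue hr p = g].

Definition coef_norm (p : {mpoly int[n]}) : nat :=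
  \max_(m <- msupp p) `|p@_m|%N.

Definition norm (g : A) : nat := coef_norm (normal_form g).

Definition coef_lattice (J : ideal A) : set {mpoly int[n]} :=
  [set normal_form g | g in J]%classic.

Definition lambda1 (R : realType) (J : ideal A) : R :=
  inf [set d | exists u v, [/\ coef_lattice J u, coef_lattice J v, u <> v &
                               d = (coef_norm (u - v))%:R]].
End Lattice.

Inductive letter := Bit of bool | Minus | Comma | Semi | Bar | Hash.
Definition word := seq letter.

Inductive move := Left | Stay | Right.

(* Deterministic one-tape machines; [None] on the tape is the blank, and the
   machine halts when the transition function returns [None]. *)
Record machine := Machine {
  state : finType;
  aux : finType;
  start : state;
  delta : state -> option (letter + aux) ->
          option (state * option (letter + aux) * move) }.

Section Run.
Variable M : machine.
Definition cell := option (letter + aux M).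

(* State, cells to the left of the head (nearest first), and cells from the
   head rightwards; all further cells are blank. *)
Definition config : Type := state M * seq cell * seq cell.

Definition init (w : word) : config :=
  (start M, [::], [seq Some (inl x) | x <- w]).

Definition step (c : config) : option config :=
  let: (q, l, t) := c in
  if delta q (head None t) is Some (q', s, d) then
    Some match d with
         | Left => (q', behead l, head None l :: s :: behead t)
         | Stay => (q', l, s :: behead t)
         | Right => (q', s :: l, behead t)
         end
  else None.

(* The halting configuration, if it is reached in at most k steps. *)
Fixpoint run (k : nat) (c : config) : option config :=
  if step c is Some c' then if k is k'.+1 then run k' c' else None
  else Some c.

Fixpoint read (t : seq cell) : word :=
  if t is Some (inl x) :: t' then x :: read t' else [::].

Definition output (c : config) : word := read c.2.
End Run.

Definition polytime (f : word -> word) : Prop :=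
  exists (M : machine) (c d : nat), forall w : word,
    exists2 h, run (c * size w ^ d + c)%N (init M w) = Some h & output h = f w.

(* [codes w x]: the word w represents the instance x;
   [solves x w]: the word w represents a solution for the instance x. *)
Record search_problem (X : Type) := SearchProblem {
  codes : word -> X -> Prop;
  solves : X -> word -> Prop }.

(* P(x k) <= Q(y k), uniformly in k: in polynomial time, any representation of
   x k is turned into one of y k, and any solution for y k into one for x k.
   Since no code of an instance below contains Hash, the pairing is
   unambiguous. *)
Definition poly_reducible (K X Y : Type) (P : search_problem X) (x : K -> X)
    (Q : search_problem Y) (y : K -> Y) : Prop :=
  exists f g : word -> word,
    [/\ polytime f, polytime g,
        forall k w, codes P w (x k) -> codes Q (f w) (y k) &
        forall k w v, codes P w (x k) -> solves Q (y k) v ->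
          solves P (x k) (g (w ++ Hash :: v))].

(* Binary digits, least significant first. *)
Definition code_nat (k : nat) : word :=
  [seq Bit (odd (k %/ 2 ^ j)) | j <- iota 0 (up_log 2 k.+1)].

Definition code_term n (c : int) (m : 'X_{1..n}) : word :=
  (if c < 0 then [:: Minus] else [::]) ++ code_nat `|c|%N ++
  flatten [seq Comma :: code_nat (m i) | i <- enum 'I_n] ++ [:: Semi].

Definition code_poly n (p : {mpoly int[n]}) : word :=
  flatten [seq code_term p@_m m | m <- msupp p].

Definition code_polys n (s : seq {mpoly int[n]}) : word :=
  flatten [seq rcons (code_poly p) Bar | p <- s].

(* In both problems ring elements are given by integer polynomials (evaluated
   at a, resp. taken modulo the ideal), and ideals by finite lists of
   generators. *)
Definition SSub (R : realType) n (I : {pred {mpoly int[n]}})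
    (a : 'I_n -> R[i]) (gamma : R) : search_problem (ideal (Zadj a)) :=
  SearchProblem
    (fun w J => exists2 s, w = code_polys s &
       ideal_set J = generated [seq Zeval a p | p <- s])
    (fun J w => exists p, let alpha := Zeval a p in
       [/\ w = code_poly p, ideal_set J alpha, alpha <> 0 &
           forall alpha', ideal_set J alpha' -> alpha' <> 0 ->
             maxsub I alpha <= gamma * maxsub I alpha']).

Definition SPP (R : realType) n (r : 'I_n -> nat)
    (hr : forall i, (2 <= r i)%N) (le : rel 'X_{1..n}) (gamma : R) :
    search_problem (ideal (cyc_ring hr)) :=
  SearchProblem
    (fun w J => exists2 s, w = code_polys s &
       ideal_set J = generated [seq residue hr p | p <- s])
    (fun J w => exists p, let g := residue hr p in
       [/\ w = code_poly p, ideal_set J g, g <> 0 &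
           (norm le g)%:R <= gamma * lambda1 le R J]).

(* Main.v *)
(* The zeros of the ideal are the points whose i-th coordinate is a nontrivial
   r_i-th root of unity, and every element of the quotient has a unique
   representative whose exponents in x_i are below r_i - 1; whatever the
   monomial order, this is its normal form. Thus N is both the number of zeros
   and the number of monomials in normal forms, and since the coordinates of
   the zeros have modulus 1, maxsub <= N * norm. Conversely, Fourier inversion
   on the product of the groups Z/r_i, corrected for the missing root 1,
   recovers a coefficient from the N values as a combination with weights of
   modulus at most prod_i (2 / r_i) <= 1, so that norm <= N * maxsub. Hence a
   solution of one problem solves the other with a loss of N^2. Both problems
   read and answer with the same words, so the instance is passed on unchanged
   and the solution is obtained by erasing the instance in front of it. *)

Require Import Defs.
From HB Require Import structures.
From mathcomp Require Import all_boot all_order all_algebra.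
From mathcomp Require Import ring_quotient separable cyclic cyclotomic.
From mathcomp Require Import boolp classical_sets cardinality reals.
From mathcomp Require Import complex mpoly ring.

Set Implicit Arguments.
Unset Strict Implicit.
Unset Printing Implicit Defensive.

Import Order.TTheory GRing.Theory Num.Theory.

Local Open Scope ring_scope.

(** * Roots of unity and one-variable Fourier inversion *)

Section RootsOfUnity.

(** In characteristic 0 the polynomial ['X^m - 1] is separable, so it has [m] distinct roots, and a
    list of [m] distinct [m]-th roots of unity contains a primitive one. *)
Lemma prim_root_exists (C : numClosedFieldType) m :
  (0 < m)%N -> exists z : C, m.-primitive_root z.
Proof.
move=> m_gt0; have [s Dp] := closed_field_poly_normal ('X^m - 1 : {poly C}).
rewrite (monicP _) ?monicXnsubC // scale1r in Dp.
have s1 : all m.-unity_root s by apply/allP=> z; rewrite -root_prod_XsubC -Dp.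
have sz_s : (m < (size s).+1)%N.
  by rewrite -(size_prod_XsubC s id) -Dp size_XnsubC.
have [|z] := hasP (has_prim_root m_gt0 s1 _ sz_s); last by exists z.
by rewrite -separable_prod_XsubC -Dp separable_Xn_sub_1 // pnatr_eq0 -lt0n.
Qed.

Variables (F : fieldType) (m : nat) (z : F).
Hypotheses (m_gt1 : (1 < m)%N) (zP : m.-primitive_root z).

Lemma sum_prim_rootX e :
  \sum_(k < m) z ^+ (k * e) = if (m %| e)%N then m%:R else 0.
Proof.
under eq_bigr => k _ do rewrite mulnC exprM.
rewrite (prim_order_dvd zP); case: eqVneq => [->|ne1].
  by under eq_bigr do rewrite expr1n; rewrite sumr_const card_ord.
apply: (mulfI (_ : z ^+ e - 1 != 0)); first by rewrite subr_eq0.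
by rewrite -subrX1 -exprM mulnC exprM (prim_expr_order zP) expr1n subrr mulr0.
Qed.

(** The Fourier weight of the root [z ^+ k.+1] for the coefficient [d], with [m - d] standing for
    [- d]; the subtracted power makes up for the missing root 1. *)
Definition dual_weight (k d : nat) : F :=
  (z ^+ (k.+1 * (m - d)) - z ^+ k.+1) / m%:R.

(* Orthogonality of the characters of Z/m, with the terms at the root 1
   removed: the values at 1 of [z ^ (e - d)] and of [z ^ (e + 1)] cancel. *)
Lemma dual_weightP e d : m%:R != 0 :> F -> (e < m.-1)%N -> (d < m.-1)%N ->
  \sum_(k < m.-1) z ^+ (k.+1 * e) * dual_weight k d = (e == d)%:R.
Proof.
move=> m0 lt_em lt_dm.
have shift f : \sum_(k < m.-1) z ^+ (k.+1 * f) =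
    (if (m %| f)%N then m%:R else 0) - 1.
  rewrite -sum_prim_rootX; case: (m) m_gt1 => // m' _.
  by rewrite big_ord_recl /= mul0n expr0 addrAC subrr add0r.
under eq_bigr => k _ do
  rewrite /dual_weight mulrA mulrBr -exprD -mulnDr -exprD -mulnSr.
(* Since [0 < e.+1 < m], the second sum is just the [- 1] left by the removed root, and it cancels
   the [- 1] of the first. *)
rewrite -mulr_suml sumrB !shift (@gtnNdvd e.+1) -?ltn_predRL //.
rewrite add0r opprK subrK.
suff -> : (m %| e + (m - d))%N = (e == d).
  by case: eqP => _; rewrite ?divff ?mul0r.
have le_dm : (d <= m)%N by apply: leq_trans (ltnW lt_dm) (leq_pred m).
rewrite addnBA // -eqn_mod_dvd; last exact: leq_trans (leq_addl _ _).
rewrite modnDr !modn_small //; exact: leq_trans (leq_pred m).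
Qed.

End RootsOfUnity.

Lemma norm_prim_root (C : numFieldType) m (z : C) :
  m.-primitive_root z -> `|z| = 1.
Proof.
move=> zP; have m_gt0 := prim_order_gt0 zP.
apply/eqP; rewrite -(pexpr_eq1 m_gt0) //.
by rewrite -normrX (prim_expr_order zP) normr1.
Qed.

Lemma norm_dual_weight_le1 (C : numFieldType) m (z : C) k d :
  (1 < m)%N -> m.-primitive_root z -> `|dual_weight m z k d| <= 1.
Proof.
move=> m_gt1 zP; rewrite normrM normfV normr_nat ler_pdivrMr ?ltr0n 1?ltnW //.
rewrite (le_trans (ler_normB _ _)) // !normrX (norm_prim_root zP) !expr1n mul1r.
by rewrite (ler_nat _ 2 m).
Qed.

(** * Box of exponents and polynomials supported in it *)

Section Box.
Variables (n : nat) (r : 'I_n -> nat).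

Definition top : nat := \max_i r i.

(* Indexes both the exponents below [r i - 1] and, after a shift by one, the
   nontrivial roots of unity that make up the zeros. *)
Definition box : {pred {ffun 'I_n -> 'I_top.+1}} :=
  [pred f : {ffun 'I_n -> 'I_top.+1} | [forall i, f i < (r i).-1]%N].

Lemma boxP (f : {ffun 'I_n -> 'I_top.+1}) :
  reflect (forall i, (f i < (r i).-1)%N) (f \in box).
Proof. exact: forallP. Qed.

(** Distributivity, with each range widened to the common ['I_top.+1]; it reduces sums over the box
    to one variable at a time. *)
Lemma sum_box_prod (S : comNzRingType) (F : 'I_n -> nat -> S) :
  \sum_(f in box) \prod_i F i (f i) = \prod_i \sum_(k < (r i).-1) F i k.
Proof.
transitivity (\prod_i \sum_(k : 'I_top.+1 | (k < (r i).-1)%N) F i k).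
  by rewrite bigA_distr_big_dep.
apply: eq_bigr => i _; rewrite -big_ord_widen //.
by apply: leq_trans (leq_pred _) _; apply: leqW; exact: leq_bigmax.
Qed.

Definition box_mon (f : {ffun 'I_n -> 'I_top.+1}) : 'X_{1..n} :=
  [multinom (f i : nat) | i < n].

Lemma box_mon_inj : injective box_mon.
Proof.
move=> f g /mnmP efg; apply/ffunP => i; apply: val_inj.
by have := efg i; rewrite !mnmE.
Qed.

Definition in_box (m : 'X_{1..n}) : bool := [forall i, m i < (r i).-1]%N.

Lemma in_box_monP m : reflect (exists2 f, f \in box & m = box_mon f) (in_box m).
Proof.
apply: (iffP forallP) => [mB|[f /boxP fB ->] i]; last by rewrite mnmE.
have lt_top i : (m i < top.+1)%N.
  apply: leq_trans (leq_trans (mB i) (leq_pred _)) _.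
  by apply: leqW; exact: leq_bigmax.
exists [ffun i => inord (m i)].
  by apply/boxP => i; rewrite ffunE inordK.
by apply/mnmP => i; rewrite mnmE ffunE inordK.
Qed.

Definition boxed (p : {mpoly int[n]}) : Prop :=
  {in msupp p, forall m, in_box m}.

Lemma boxedB p q : boxed p -> boxed q -> boxed (p - q).
Proof.
move=> pB qB m; rewrite mcoeff_msupp mcoeffB => pq_m.
have [/pB //|] := boolP (m \in msupp p).
rewrite -mcoeff_eq0 => /eqP pm0; apply: qB.
by move: pq_m; rewrite pm0 sub0r oppr_eq0 mcoeff_msupp.
Qed.

Lemma boxed_expand p : boxed p ->
  p = \sum_(f in box) p@_(box_mon f) *: 'X_[box_mon f].
Proof.
move=> pB; apply/mpolyP => m; rewrite raddf_sum /=.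
under eq_bigr => f _ do rewrite mcoeffZ mcoeffX.
have [/in_box_monP [f fB ->]|mB] := boolP (in_box m).
  rewrite (bigD1 f) //= eqxx mulr1 big1 ?addr0 // => g /andP [_ gf].
  by rewrite (inj_eq box_mon_inj) (negPf gf) mulr0.
rewrite big1 => [|f fB].
  by apply/eqP; rewrite mcoeff_eq0; apply: contra mB; exact: pB.
have [e|_] := eqVneq; last by rewrite mulr0.
by case/in_box_monP: mB; exists f.
Qed.

End Box.
Arguments box {n} r.

(** * Evaluation of integer polynomials at complex points *)

Section Evaluation.
Variables (R : rcfType) (n : nat).
Implicit Types (b : 'I_n -> R[i]) (p q : {mpoly int[n]}).

Lemma evalCD b : {morph evalC b : p q / p + q}.
Proof. by move=> p q; rewrite /evalC !rmorphD. Qed.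

Lemma evalCM b : {morph evalC b : p q / p * q}.
Proof. by move=> p q; rewrite /evalC !rmorphM. Qed.

Lemma evalCB b : {morph evalC b : p q / p - q}.
Proof. by move=> p q; rewrite /evalC !rmorphB. Qed.

Lemma evalC_sum b (J : Type) (s : seq J) (P : pred J)
    (G : J -> {mpoly int[n]}) :
  evalC b (\sum_(x <- s | P x) G x) = \sum_(x <- s | P x) evalC b (G x).
Proof. by apply: big_morph; [exact: evalCD | rewrite /evalC !rmorph0]. Qed.

Lemma evalCZX b c m : evalC b (c *: 'X_[m]) = c%:~R * \prod_i b i ^+ m i.
Proof. by rewrite /evalC map_mpolyZ map_mpolyX mevalZ mevalX. Qed.

Lemma evalC_cyc_gen b (r : 'I_n -> nat) i :
  evalC b (cyc_gen r i) = \sum_(k < r i) b i ^+ k.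
Proof.
rewrite evalC_sum; apply: eq_bigr => k _.
by rewrite /evalC !rmorphXn /= map_mpolyX mevalXU.
Qed.

End Evaluation.

(** Coefficients indexed by [nat] do not depend on the length of the list, so that length can be
    rewritten freely. *)
Lemma generatedP (A : comNzRingType) (s : seq A) x :
  generated s x <-> exists c : nat -> A, x = \sum_(i < size s) c i * s`_i.
Proof.
split=> [[c ->]|[c ->]].
  exists (fun i => oapp c 0 (insub i)); apply: eq_bigr => i _.
  by rewrite valK (tnth_nth 0).
by exists (fun i => c i); apply: eq_bigr => i _; rewrite (tnth_nth 0).
Qed.

(** * The zeros of the ideal and Fourier inversion over them *)

Section Zeros.
Variables (R : rcfType) (n : nat) (r : 'I_n -> nat).
Hypothesis hr : forall i, (2 <= r i)%N.
Local Notation I := (cyc_ideal hr).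

Lemma cyc_gen_ideal i : cyc_gen r i \in I.
Proof.
apply/asboolP/generatedP; rewrite size_map size_enum_ord.
exists (fun j => (j == i :> nat)%:R); rewrite (bigD1 i) //= eqxx mul1r.
rewrite (nth_map i) ?size_enum_ord // nth_ord_enum big1 ?addr0 // => j ji.
by rewrite (inj_eq val_inj) (negPf ji) mul0r.
Qed.

Lemma cyc_idealP p : p \in I <->
  exists c : 'I_n -> {mpoly int[n]}, p = \sum_i c i * cyc_gen r i.
Proof.
split=> [/asboolP/generatedP|[c ->]]; last first.
  by apply: rpred_sum => i _; apply: idealMr; exact: cyc_gen_ideal.
rewrite size_map size_enum_ord => -[c ->].
exists (fun i : 'I_n => c i); apply: eq_bigr => i _.
by rewrite (nth_map i) ?size_enum_ord // nth_ord_enum.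
Qed.

Lemma zerosP (b : 'I_n -> R[i]) :
  zeros I b <-> forall i, \sum_(k < r i) b i ^+ k = 0.
Proof.
split=> [b0 i|b0 p /cyc_idealP [c ->]].
  by rewrite -evalC_cyc_gen; apply: b0; exact: cyc_gen_ideal.
by rewrite evalC_sum big1 // => i _; rewrite evalCM evalC_cyc_gen b0 mulr0.
Qed.

Variable z : 'I_n -> R[i].
Hypothesis zP : forall i, (r i).-primitive_root (z i).

Definition zero_at (f : {ffun 'I_n -> 'I_(top r).+1}) (i : 'I_n) : R[i] :=
  z i ^+ (f i).+1.

Lemma zero_at_inj : {in box r &, injective zero_at}.
Proof.
move=> f g /boxP fB /boxP gB efg; apply/ffunP => i; apply: val_inj.
have /eqP := congr1 (fun h => h i) efg.
rewrite /zero_at (eq_prim_root_expr (zP i)).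
by rewrite !modn_small -?ltn_predRL // => /eqP [].
Qed.

Lemma zerosE : zeros I = [set zero_at f | f in [set` box r]]%classic.
Proof.
apply/seteqP; split=> [b /zerosP b0|_ [f /boxP fB <-]] /=; last first.
  (* Multiplying by [zero_at f i - 1], nonzero because [0 < (f i).+1 < r i], turns the sum into
     [zero_at f i ^+ r i - 1]. *)
  apply/zerosP => i; apply: (mulfI (_ : zero_at f i - 1 != 0)).
    rewrite subr_eq0 /zero_at -(prim_order_dvd (zP i)) gtnNdvd //.
    by rewrite -ltn_predRL.
  rewrite -subrX1 /zero_at -exprM mulnC exprM (prim_expr_order (zP i)).
  by rewrite expr1n subrr mulr0.
(* By [subrX1] each coordinate is a power of [z i]. Exponent 0 would make the sum equal to [r i],
   which is not 0; the remaining exponents are shifted down by one. *)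
have root_b i : {k : 'I_(top r).+1 | (k < (r i).-1)%N & b i = z i ^+ k.+1}.
  have b1 : b i ^+ r i = 1.
    by apply/eqP; rewrite -subr_eq0 subrX1 b0 mulr0.
  have [[[|k] lt_k] /= bk] := prim_rootP (zP i) b1.
    have := b0 i; rewrite bk.
    under eq_bigr do rewrite expr0 expr1n.
    rewrite sumr_const card_ord => /eqP; rewrite pnatr_eq0.
    by move: (hr i); case: (r i).
  have lt_top : (k < (top r).+1)%N.
    by apply: leq_trans (ltnW lt_k) _; apply: leqW; exact: leq_bigmax.
  by exists (Ordinal lt_top); rewrite //= ltn_predRL.
exists [ffun i => s2val (root_b i)].
  by apply/boxP => i; rewrite ffunE; case: (root_b i).
by apply/funext => i; rewrite /zero_at ffunE; case: (root_b i).
Qed.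

Lemma card_zeros N : card_eq (@zeros R n I) `I_N -> N = #|box r|.
Proof.
move=> cN; apply/card_eq_II; apply: card_eq_trans (card_esym cN) _.
rewrite zerosE; apply: card_eq_trans (inj_card_eq _) _.
  by move=> f g; rewrite !mem_setE; exact: zero_at_inj.
have -> : [set` box r]%classic =
    [set enum_val i | i in [set: 'I_#|box r|]]%classic.
  apply/seteqP; split=> [f fB|_ [i _ <-]] /=; last exact: enum_valP.
  by exists (enum_rank_in fB f); rewrite ?enum_rankK_in.
apply: card_eq_trans (inj_card_eq _) (card_esym card_II).
exact: in2W enum_val_inj.
Qed.

Lemma boxed_evalC b p : boxed r p ->
  evalC b p = \sum_(f in box r) (p@_(box_mon f))%:~R *
    \prod_i (b i : R[i]) ^+ box_mon f i.
Proof.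
move=> pB; rewrite {1}(boxed_expand pB) evalC_sum.
by apply: eq_bigr => f _; exact: evalCZX.
Qed.

(** Fourier inversion in several variables: after the sums are exchanged, the inner one factors by
    [sum_box_prod], and [dual_weightP] applies to each factor. *)
Lemma boxed_coefP p d : boxed r p -> d \in box r ->
  \sum_(f in box r) evalC (zero_at f) p *
     \prod_i dual_weight (r i) (z i) (f i) (d i) = (p@_(box_mon d))%:~R.
Proof.
move=> pB /[dup] dB /boxP lt_d.
transitivity (\sum_(f in box r) \sum_(e in box r) (p@_(box_mon e))%:~R *
    \prod_i (zero_at f i ^+ box_mon e i *
              dual_weight (r i) (z i) (f i) (d i))).
  apply: eq_bigr => f _; rewrite (boxed_evalC _ pB) mulr_suml.
  by apply: eq_bigr => e _; rewrite -mulrA -big_split.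
rewrite exchange_big /=.
under eq_bigr => e _ do rewrite -mulr_sumr.
have orth e : e \in box r ->
  \sum_(f in box r) \prod_i (zero_at f i ^+ box_mon e i *
     dual_weight (r i) (z i) (f i) (d i)) = (e == d)%:R.
  move=> /boxP lt_e.
  rewrite (sum_box_prod r (fun i k => (z i ^+ k.+1) ^+ box_mon e i *
     dual_weight (r i) (z i) k (d i))).
  rewrite (eq_bigr (fun i => (e i == d i :> nat)%:R)) => [|i _]; last first.
    have r0 : (r i)%:R != 0 :> R[i] by rewrite pnatr_eq0 -lt0n ltnW.
    rewrite mnmE -(dual_weightP (hr i) (zP i) r0 (lt_e i) (lt_d i)).
    by apply: eq_bigr => k _; rewrite -exprM.
  have [->|ne_ed] := eqVneq; first by rewrite big1 // => i _; rewrite eqxx.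
  have [i ne_i] : exists i, e i != d i :> nat.
    apply/existsP; apply: contra_neqT ne_ed; rewrite negb_exists => /forallP h.
    apply/ffunP => i; apply/val_inj/eqP; rewrite -[_ == _]negbK; exact: h.
  by rewrite (bigD1 i) //= (negPf ne_i) mul0r.
rewrite (bigD1 d) //= orth // eqxx mulr1 big1 ?addr0 // => e.
by case/andP => eB /negPf ne; rewrite orth // ne mulr0.
Qed.

End Zeros.

(** * Boxed representatives in the quotient ring *)

Section QuotientRing.
Variables (n : nat) (r : 'I_n -> nat).
Hypothesis hr : forall i, (2 <= r i)%N.
Local Notation I := (cyc_ideal hr).

Lemma residue_is_zmod_morphism : zmod_morphism (residue hr).
Proof. by move=> p q; rewrite /residue rmorphB. Qed.

Lemma residue_is_monoid_morphism : monoid_morphism (residue hr).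
Proof. by split=> [|p q]; rewrite /residue ?rmorph1 ?rmorphM. Qed.

HB.instance Definition _ :=
  GRing.isZmodMorphism.Build _ _ (residue hr) residue_is_zmod_morphism.
HB.instance Definition _ :=
  GRing.isMonoidMorphism.Build _ _ (residue hr) residue_is_monoid_morphism.

Lemma residue_eq p q : residue hr p = residue hr q <-> p - q \in I.
Proof. by rewrite Quotient.idealrBE; split=> /eqP. Qed.

Lemma residue_surj g : exists p, residue hr p = g.
Proof. by exists (repr g); exact: reprK. Qed.

Lemma residueZ c p : residue hr (c *: p) = residue hr p *~ c.
Proof. by rewrite -{1}[c]intz scaler_int raddfMz. Qed.

Definition box_rep (p : {mpoly int[n]}) : Prop :=
  exists2 q, boxed r q & residue hr q = residue hr p.

Lemma box_repB p q : box_rep p -> box_rep q -> box_rep (p - q).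
Proof.
move=> [p' p'B ep] [q' q'B eq]; exists (p' - q'); first exact: boxedB.
by rewrite !rmorphB /= ep eq.
Qed.

Lemma box_rep0 : box_rep 0.
Proof. by exists 0 => // m; rewrite msupp0. Qed.

Lemma box_repD p q : box_rep p -> box_rep q -> box_rep (p + q).
Proof.
move=> pR qR; rewrite -[q]opprK -[- q]add0r.
by apply: box_repB pR _; apply: box_repB box_rep0 _.
Qed.

Lemma box_repZ c p : box_rep p -> box_rep (c *: p).
Proof.
move=> [q qB eq]; exists (c *: q); last by rewrite !residueZ eq.
by move=> m /msuppZ_le; exact: qB.
Qed.

Lemma box_rep_sum (J : Type) (s : seq J) (P : pred J)
    (G : J -> {mpoly int[n]}) :
  (forall j, P j -> box_rep (G j)) -> box_rep (\sum_(j <- s | P j) G j).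
Proof. by move=> GR; apply: big_ind; [exact: box_rep0 | exact: box_repD |]. Qed.

Lemma box_rep_eq p q : residue hr p = residue hr q -> box_rep p -> box_rep q.
Proof. by move=> epq [p' p'B ep]; exists p'; rewrite // ep. Qed.

Lemma box_rep_mon m : in_box r m -> box_rep 'X_[m].
Proof. by move=> mB; exists 'X_[m] => // m'; rewrite msuppX inE => /eqP ->. Qed.

(** Only the exponent of ['X_i] can leave the box, and then it equals [(r i).-1]; a monomial
    multiple of [cyc_gen r i] trades that power for minus the sum of the lower ones. *)
Lemma box_rep_mulX i m : in_box r m -> box_rep ('X_i * 'X_[m]).
Proof.
move=> mB; rewrite -mpolyXD; have /forallP lt_m := mB.
pose m0 := [multinom if j == i then 0%N else m j | j < n].
have in_box_m0 (k : nat) : (k < (r i).-1)%N -> in_box r (m0 + U_(i) *+ k)%MM.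
  move=> lt_k; apply/forallP => j; rewrite mnmDE mnmE mulmnE mnm1E eq_sym.
  by case: eqP => [<-|_]; rewrite ?mul1n ?mul0n ?addn0.
have eq_m0 : (m0 + U_(i) *+ (m i).+1)%MM = (U_(i) + m)%MM.
  apply/mnmP => j; rewrite !mnmDE mnmE mulmnE mnm1E eq_sym.
  by case: eqP => [<-|_]; rewrite ?mul1n ?mul0n ?addn0.
have [lt_mi|ge_mi] := ltnP (m i).+1 (r i).-1.
  by rewrite -eq_m0; apply: box_rep_mon; exact: in_box_m0.
have eq_mi : (m i).+1 = (r i).-1 by apply/eqP; rewrite eqn_leq ge_mi lt_m.
apply: (@box_rep_eq (- \sum_(k < (r i).-1) 'X_[m0 + U_(i) *+ k])).
  apply/residue_eq; rewrite -opprD rpredN.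
  suff -> : \sum_(k < (r i).-1) 'X_[m0 + U_(i) *+ k] + 'X_[U_(i) + m] =
      'X_[m0] * cyc_gen r i :> {mpoly int[n]}.
    by apply: idealMr; exact: cyc_gen_ideal.
  rewrite /cyc_gen mulr_sumr -(prednK (ltnW (hr i))) big_ord_recr /=.
  rewrite -eq_m0 eq_mi mpolyXD mpolyXn; congr (_ + _).
  by apply: eq_bigr => k _; rewrite mpolyXD mpolyXn.
rewrite -sub0r; apply: box_repB box_rep0 _.
by apply: box_rep_sum => k _; apply: box_rep_mon; exact: in_box_m0.
Qed.

(** For monomials, by induction on the degree: one variable is split off, the rest gets a boxed
    representative, and [box_rep_mulX] multiplies the variable back term by term. *)
Lemma boxed_repP p : box_rep p.
Proof.
have repX m : box_rep 'X_[m].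
  have [d] := ubnP (mdeg m); elim: d m => // d IHd m lt_m.
  have [->|] := eqVneq m 0%MM.
    apply: box_rep_mon; apply/forallP => i; rewrite mnm0E.
    by move: (hr i); case: (r i) => [|[|]].
  rewrite -mdeg_eq0 mdegE sum_nat_eq0 => /forallPn [i /=] m_i.
  have le_i : (U_(i) <= m)%MM by rewrite lep1mP.
  have [|q qB eq] := IHd (m - U_(i))%MM.
    move: lt_m; rewrite -{1}(submK le_i) mdegD mdeg1 addn1; exact.
  apply: (@box_rep_eq ('X_i * q)).
    by rewrite rmorphM /= eq -rmorphM /= -mpolyXD addmC submK.
  rewrite (boxed_expand qB) mulr_sumr; apply: box_rep_sum => f fB.
  rewrite -scalerAr; apply: box_repZ; apply: box_rep_mulX.
  by apply/in_box_monP; exists f.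
rewrite [p]mpolyE; apply: box_rep_sum => m _.
by apply: box_repZ; exact: repX.
Qed.

End QuotientRing.

(** * Uniqueness of boxed representatives, freeness, normal forms *)

Section BoxedNormalForms.
Variables (R : realType) (n : nat) (r : 'I_n -> nat).
Hypothesis hr : forall i, (2 <= r i)%N.
Local Notation I := (cyc_ideal hr).

Lemma prim_roots_exist :
  exists z : 'I_n -> R[i], forall i, (r i).-primitive_root (z i).
Proof.
have zP i : exists z : R[i], (r i).-primitive_root z.
  by apply: prim_root_exists; exact: ltnW.
by exists (fun i => projT1 (cid (zP i))) => i; exact: projT2 (cid (zP i)).
Qed.

(** Elements of the ideal vanish at all zeros, and Fourier inversion recovers each coefficient in
    the box from these values. *)
Lemma boxed_ideal0 p : boxed r p -> p \in I -> p = 0.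
Proof.
move=> pB pI; have [z zP] := prim_roots_exist.
rewrite (boxed_expand pB) big1 // => d dB.
suff -> : p@_(box_mon d) = 0 by rewrite scale0r.
apply/eqP; rewrite -(intr_eq0 R[i]) -(boxed_coefP hr zP pB dB) big1 // => f fB.
suff -> : evalC (zero_at z f) p = 0 by rewrite mul0r.
suff : zeros I (zero_at z f) by exact.
by rewrite (zerosE hr zP); exists f.
Qed.

Lemma boxed_residue_inj p q :
  boxed r p -> boxed r q -> residue hr p = residue hr q -> p = q.
Proof.
move=> pB qB /residue_eq pqI; apply/eqP; rewrite -subr_eq0; apply/eqP.
by apply: boxed_ideal0 => //; exact: boxedB.
Qed.

Lemma cyc_ring_free : free_fin_gen (cyc_ring hr).
Proof.
pose X (i : 'I_#|box r|) : {mpoly int[n]} := 'X_[box_mon (enum_val i)].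
pose Q (c : 'rV[int]_#|box r|) := \sum_i c 0 i *: X i.
have residueQ c : residue hr (Q c) = \sum_i residue hr (X i) *~ c 0 i.
  by rewrite rmorph_sum; apply: eq_bigr => i _; exact: residueZ.
have boxedQ c : boxed r (Q c).
  move=> m; apply: contraLR => mB.
  rewrite -mcoeff_eq0 raddf_sum big1 //= => i _.
  rewrite mcoeffZ mcoeffX; have [e|_] := eqVneq; last by rewrite mulr0.
  by case/in_box_monP: mB; exists (enum_val i); first exact: enum_valP.
have coefQ c i : (Q c)@_(box_mon (enum_val i)) = c 0 i.
  rewrite raddf_sum (bigD1 i) //= mcoeffZ mcoeffX eqxx mulr1.
  rewrite big1 ?addr0 // => j ji; rewrite mcoeffZ mcoeffX.
  by rewrite (inj_eq (@box_mon_inj _ _)) (inj_eq enum_val_inj) (negPf ji) mulr0.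
exists #|box r|, (fun i => residue hr (X i)) => v.
have [p <-] := residue_surj v; have [q qB <-] := boxed_repP hr p.
exists (\row_i q@_(box_mon (enum_val i))); split=> [|c].
  rewrite -residueQ; congr residue; rewrite {1}(boxed_expand qB) big_enum_val.
  by apply: eq_bigr => i _; rewrite mxE.
rewrite -residueQ => /(boxed_residue_inj qB (boxedQ c)) ->.
by apply/rowP => i; rewrite mxE coefQ.
Qed.

Variable le : rel 'X_{1..n}.
Hypotheses (le_mo : monomial_order le) (le_basis : monomial_basis hr le).

(** If the exponent of ['X_i] in [m] is at least [(r i).-1], then [m] leads a monomial multiple of
    [cyc_gen r i] for every monomial order, since all terms of that multiple divide [m]. *)
Lemma reduced_boxed p : reduced le I p -> boxed r p.
Proof.
move=> pR m mp; apply/forallP => i; rewrite ltnNge; apply/negP => ge_mi.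
pose m0 : 'X_{1..n} := (m - U_(i) *+ (r i).-1)%MM.
have em : m = (m0 + U_(i) *+ (r i).-1)%MM.
  rewrite submK //; apply/mnm_lepP => j; rewrite mulmnE mnm1E.
  by case: eqP => [<-|_]; rewrite ?mul1n ?mul0n.
pose q : {mpoly int[n]} := 'X_[m0] * cyc_gen r i.
have qE : q = \sum_(k < r i) 'X_[m0 + U_(i) *+ k].
  rewrite /q mulr_sumr; apply: eq_bigr => k _.
  by rewrite mpolyXD mpolyXn.
(* Each coefficient of [q] counts the terms equal to [m'], so it is nonzero exactly when some term
   is [m']. *)
have coefq m' : q@_m' = (\sum_(k < r i) (m0 + U_(i) *+ k == m')%MM)%:R.
  by rewrite qE raddf_sum natr_sum; apply: eq_bigr => k _; rewrite /= mcoeffX.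
apply: (pR m mp); exists q; first by apply: idealMr; exact: cyc_gen_ideal.
split=> [|m'].
  rewrite mcoeff_msupp coefq pnatr_eq0 -lt0n.
  have lt_r : ((r i).-1 < r i)%N by rewrite prednK // ltnW.
  by rewrite (bigD1 (Ordinal lt_r)) //= -em eqxx.
rewrite mcoeff_msupp coefq pnatr_eq0 sum_nat_eq0 => /forallPn [k /=].
rewrite eqb0 negbK => /eqP <-.
have le_k : (k <= (r i).-1)%N by rewrite -ltnS prednK // ltnW.
have -> : m = (U_(i) *+ ((r i).-1 - k) + (m0 + U_(i) *+ k))%MM.
  rewrite em; apply/mnmP => j; rewrite !mnmDE !mulmnE addnCA -mulnDr.
  by rewrite subnK.
rewrite -{1}[(m0 + _)%MM]add0m; apply: (mo_add le_mo).
exact: mo_min le_mo _.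
Qed.

Local Notation nf := (normal_form (hr := hr) le).

Lemma nf_reduced g : reduced le I (nf g) /\ residue hr (nf g) = g.
Proof.
apply: (@xgetPex _ 0 [set p | reduced le I p /\ residue hr p = g]%classic).
by have [p [pP _]] := le_basis g; exists p.
Qed.

Lemma nf_boxed g : boxed r (nf g).
Proof. by apply: reduced_boxed; exact: (nf_reduced g).1. Qed.

Lemma residue_nf g : residue hr (nf g) = g.
Proof. exact: (nf_reduced g).2. Qed.

(** Both sides are boxed with the same residue. Distances in the coefficient lattice thereby become
    norms of ring elements. *)
Lemma nfB g h : nf (g - h) = nf g - nf h.
Proof.
apply: boxed_residue_inj; first exact: nf_boxed.
  by apply: boxedB; exact: nf_boxed.
by rewrite rmorphB /= !residue_nf.
Qed.

End BoxedNormalForms.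

(** * The maximum norm of coefficients *)

Section CoefNorm.
Variable n : nat.
Implicit Types p : {mpoly int[n]}.

Lemma mcoeff_le_coef_norm p m : (`|p@_m| <= coef_norm p)%N.
Proof.
have [mp|] := boolP (m \in msupp p); first exact: leq_bigmax_seq.
by rewrite -mcoeff_eq0 => /eqP ->.
Qed.

Lemma coef_norm_eq0 p : coef_norm p = 0%N -> p = 0.
Proof.
move=> p0; apply/mpolyP => m; apply/eqP; rewrite mcoeff0 -absz_eq0 -leqn0 -p0.
exact: mcoeff_le_coef_norm.
Qed.

End CoefNorm.

(** The modulus in [R[i]] is a complex number with zero imaginary part; this passes between real
    bounds and the order of [R[i]]. *)
Lemma Re_norm_le (R : rcfType) (x : R[i]) (y : R) :
  (complex.Re `|x| <= y) = (`|x| <= y%:C%C).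
Proof. by rewrite -lecR. Qed.

Lemma norm_intr (F : numDomainType) (c : int) : `|c%:~R| = `|c|%N%:R :> F.
Proof. by rewrite -intr_norm -abszE pmulrn. Qed.

(** * Comparison of [norm], [maxsub] and [lambda1] *)

Section Bounds.
Variables (R : realType) (n : nat) (r : 'I_n -> nat).
Hypothesis hr : forall i, (2 <= r i)%N.
Local Notation I := (cyc_ideal hr).
Variable N : nat.
Hypothesis card_N : card_eq (@zeros R n I) `I_N.

Lemma evalC_le_coef_norm (b : 'I_n -> R[i]) p : boxed r p -> zeros I b ->
  complex.Re `|evalC b p| <= N%:R * (coef_norm p)%:R.
Proof.
have [z zP] := prim_roots_exist R hr.
(* [N] counts the zeros by hypothesis and the box monomials by [card_zeros]; here it bounds the
   number of terms of [p]. *)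
rewrite (card_zeros zP card_N) (zerosE hr zP) => pB [f _ <-].
rewrite Re_norm_le -natrM rmorph_nat natrM mulr_natl -sumr_const.
rewrite (boxed_evalC _ pB) (le_trans (ler_norm_sum _ _ _)) //.
apply: ler_sum => e _; rewrite normrM normr_prod big1 ?mulr1 => [|i _].
  by rewrite norm_intr ler_nat mcoeff_le_coef_norm.
by rewrite !normrX (norm_prim_root (zP i)) !expr1n.
Qed.

Lemma coef_norm_le_evalC p K : boxed r p ->
  (forall b : 'I_n -> R[i], zeros I b -> complex.Re `|evalC b p| <= K) ->
  (coef_norm p)%:R <= N%:R * K.
Proof.
have [z zP] := prim_roots_exist R hr => pB le_K.
have le_coef d : d \in box r -> `|p@_(box_mon d)|%N%:R <= N%:R * K.
  move=> dB; rewrite -lecR rmorphM /= !rmorph_nat (card_zeros zP card_N).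
  rewrite -norm_intr -(boxed_coefP hr zP pB dB) mulr_natl -sumr_const.
  rewrite (le_trans (ler_norm_sum _ _ _)) //; apply: ler_sum => f fB.
  rewrite normrM -[leRHS]mulr1 ler_pM // ?normr_ge0 //.
    by rewrite -Re_norm_le le_K // (zerosE hr zP); exists f.
  rewrite normr_prod prodr_ile1 // => i _.
  by rewrite normr_ge0 norm_dual_weight_le1.
rewrite /coef_norm big_seq.
apply: (big_ind (fun m : nat => m%:R <= N%:R * K)) => [|m1 m2 le1 le2|m mp].
(* The neutral element of the maximum requires [0 <= N%:R * K]; the constant monomial, which lies in
   the box since [r i] is at least 2, provides it. *)
- apply: le_trans (le_coef [ffun=> ord0] _); first exact: ler0n.
  by apply/boxP => i; rewrite ffunE /= -ltnS prednK // ltnW.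
- by rewrite /maxn; case: ifP.
- by have /in_box_monP [d dB ->] := pB m mp; exact: le_coef.
Qed.

Variable le : rel 'X_{1..n}.
Hypotheses (le_mo : monomial_order le) (le_basis : monomial_basis hr le).
Local Notation nf := (normal_form (hr := hr) le).

Section Maxsub.
Variables (a : 'I_n -> R[i]) (phi : Zadj a -> cyc_ring hr).
Hypotheses (Va : zeros I a) (phiE : forall p, phi (Zeval a p) = residue hr p).

(** Through [phi], any two expressions of [alpha] have the same residue, so they differ by an
    element of the ideal, which vanishes at every zero and not only at [a]. *)
Lemma evalC_expression alpha (b : 'I_n -> R[i]) : zeros I b ->
  evalC b (expression alpha) = evalC b (nf (phi alpha)).
Proof.
move=> b0; apply/eqP; rewrite -subr_eq0 -evalCB; apply/eqP/b0/residue_eq.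
rewrite (residue_nf le_basis) -phiE; congr (phi _).
apply: (@xgetPex _ 0 [set p | Zeval a p = alpha]%classic).
have /asboolP [p ep] := Zval_adj alpha.
by exists p; apply: val_inj.
Qed.

(** Makes the [sup] in [maxsub] a genuine supremum: the point [a] gives nonemptiness, and the norm
    gives an upper bound. *)
Lemma maxsub_has_sup (alpha : Zadj a) :
  has_sup
    [set complex.Re `|evalC b (expression alpha)| | b in @zeros R n I]%classic.
Proof.
split; first by exists (complex.Re `|evalC a (expression alpha)|), a.
exists (N%:R * (norm le (phi alpha))%:R : R) => _ [b b0 <-].
by rewrite evalC_expression // evalC_le_coef_norm //; exact: nf_boxed.
Qed.

Lemma maxsub_le_norm alpha : maxsub I alpha <= N%:R * (norm le (phi alpha))%:R.
Proof.
apply: ge_sup; first exact: (maxsub_has_sup alpha).1.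
move=> _ [b b0 <-]; rewrite evalC_expression //.
by apply: evalC_le_coef_norm => //; exact: nf_boxed.
Qed.

Lemma norm_le_maxsub alpha : (norm le (phi alpha))%:R <= N%:R * maxsub I alpha.
Proof.
apply: coef_norm_le_evalC => [|b b0]; first exact: nf_boxed.
rewrite -evalC_expression //; apply: ub_le_sup; last by exists b.
exact: (maxsub_has_sup alpha).2.
Qed.

End Maxsub.

Lemma norm_gt0 (g : cyc_ring hr) : g <> 0 -> (0 < norm le g)%N.
Proof.
move=> g0; rewrite lt0n; apply/eqP => /coef_norm_eq0 nf0; apply: g0.
by rewrite -(residue_nf le_basis g) nf0 rmorph0.
Qed.

Lemma lambda1_le_norm (J : ideal (cyc_ring hr)) (g : cyc_ring hr) :
  ideal_set J g -> g <> 0 -> lambda1 le R J <= (norm le g)%:R.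
Proof.
move=> Jg g0; apply: ge_inf; first by exists 0 => _ [u [v [_ _ _ ->]]].
have nf0 : nf 0 = 0.
  by rewrite -(subrr (0 : cyc_ring hr)) (nfB R le_mo le_basis) subrr.
exists (nf g), (nf 0); split; rewrite ?nf0 ?subr0 //.
- by exists g.
- by exists 0; rewrite ?nf0 //; exact: ideal0.
- move=> nfg0; apply: g0; by rewrite -(residue_nf le_basis g) nfg0 rmorph0.
Qed.

(** The nonzero element keeps the set under the infimum nonempty; the distance between two distinct
    lattice vectors is the norm of the nonzero element [g1 - g2]. *)
Lemma le_lambda1 (J : ideal (cyc_ring hr)) (K : R) :
  (exists2 g, ideal_set J g & g <> 0) ->
  (forall g, ideal_set J g -> g <> 0 -> K <= (norm le g)%:R) ->
  K <= lambda1 le R J.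
Proof.
move=> [g Jg g0] K_le; apply: lb_le_inf.
  exists (coef_norm (nf g - nf 0))%:R, (nf g), (nf 0); split=> //.
  - by exists g.
  - by exists 0; rewrite // ; exact: ideal0.
  - by move/(congr1 (residue hr)); rewrite !(residue_nf le_basis).
move=> _ [_ [_ [[g1 J1 <-] [g2 J2 <-] ne ->]]].
rewrite -(nfB R le_mo le_basis); apply: K_le.
  by rewrite -mulN1r; apply: idealD => //; exact: idealM.
by move/eqP; rewrite subr_eq0 => /eqP e; apply: ne; rewrite e.
Qed.

End Bounds.

(** * Polynomial time machines and the separator [Hash] *)

Section Words.

Lemma polytime_id : polytime id.
Proof.
exists (@Machine unit void tt (fun _ _ => None)), 0%N, 0%N => w.
exists (init _ w) => //.
by rewrite /output /=; elim: w => //= x w ->.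
Qed.

Fixpoint after_hash (w : word) : word :=
  match w with
  | [::] => [::]
  | Hash :: w' => w'
  | _ :: w' => after_hash w'
  end.

(** Letters are blanked rather than shifted: the output is read from the head rightwards, so halting
    just after the first [Hash] is enough. *)
Definition hash_eraser : machine :=
  @Machine bool void false (fun q c =>
    match q, c with
    | false, Some (inl Hash) => Some (true, None, Right)
    | false, Some _ => Some (false, None, Right)
    | _, _ => None
    end).

Lemma run_hash_eraser k l (w : word) : (size w < k)%N ->
  exists2 h,
    run k ((false, l, [seq Some (inl x) | x <- w]) : config hash_eraser) =
      Some h & output h = after_hash w.
Proof.
elim: w k l => [|x w IHw] [|k] l //= lt_k.
  by exists (false, l, [::]).
case: x => [b|||||] /=; try exact: IHw.
exists (true, None :: l, [seq Some (inl x) | x <- w]); first by case: (k).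
by rewrite /output /=; elim: w {IHw lt_k} => //= x w ->.
Qed.

Lemma polytime_after_hash : polytime after_hash.
Proof.
(* The time bound becomes [size w + 1], while the head makes at most one step per letter. *)
exists hash_eraser, 1%N, 1%N => w; apply: run_hash_eraser.
by rewrite mul1n expn1 addn1.
Qed.

Definition not_hash (x : letter) : bool := if x is Hash then false else true.

Lemma after_hash_cat w v : all not_hash w -> after_hash (w ++ Hash :: v) = v.
Proof. by elim: w => //= -[]. Qed.

Lemma all_flatten_map (T : Type) (g : T -> word) s :
  (forall x, all not_hash (g x)) -> all not_hash (flatten [seq g x | x <- s]).
Proof. by move=> gN; elim: s => //= x s IHs; rewrite all_cat gN. Qed.

Lemma code_nat_not_hash k : all not_hash (code_nat k).
Proof. by rewrite all_map; apply/allP. Qed.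

Lemma code_polys_not_hash n (s : seq {mpoly int[n]}) :
  all not_hash (code_polys s).
Proof.
apply: all_flatten_map => p; rewrite all_rcons; apply: all_flatten_map => m.
rewrite /code_term !all_cat code_nat_not_hash andbT.
rewrite all_flatten_map => [|i]; last exact: code_nat_not_hash.
by case: ifP.
Qed.

End Words.

(** * Generators of ideals under a ring isomorphism *)

Section Transport.
Variables (A B : comNzRingType) (f : {rmorphism A -> B}).
Hypothesis f_bij : bijective f.

(** The coefficients of a combination are carried along [f] in one direction and along its inverse
    in the other. *)
Lemma generated_preim (s : seq A) :
  generated s = (f @^-1` generated [seq f x | x <- s])%classic.
Proof.
have [g fK gK] := f_bij; apply/seteqP; split=> x /=.
  move/generatedP => [c ->]; apply/generatedP; rewrite size_map.
  exists (fun i => f (c i)); rewrite rmorph_sum; apply: eq_bigr => i _.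
  by rewrite rmorphM (nth_map 0).
move/generatedP; rewrite size_map => -[c ec]; apply/generatedP.
exists (fun i => g (c i)); apply: (bij_inj f_bij); rewrite ec rmorph_sum.
apply: eq_bigr => i _.
by rewrite rmorphM /= gK (nth_map 0).
Qed.

End Transport.

(** * Solutions of each problem solve the other *)

Section Reductions.
Variables (R : realType) (n : nat) (r : 'I_n -> nat).
Hypothesis hr : forall i, (2 <= r i)%N.
Local Notation I := (cyc_ideal hr).
Variables (N : nat) (le : rel 'X_{1..n}) (gamma : R).
Hypotheses (card_N : card_eq (@zeros R n I) `I_N).
Hypotheses (le_mo : monomial_order le) (le_basis : monomial_basis hr le).
Variables (a : 'I_n -> R[i]) (phi : {rmorphism Zadj a -> cyc_ring hr}).
Hypotheses (Va : zeros I a) (phiE : forall p, phi (Zeval a p) = residue hr p).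
Hypothesis phi_bij : bijective phi.

(** The same list of polynomials generates both ideals, because [phi] sends the value of [p] at [a]
    to the residue of [p]. *)
Lemma codes_transport (gamma1 gamma2 : R) w J :
  codes (SPP hr le gamma1) w J <->
  codes (SSub I a gamma2) w (preim_ideal phi J).
Proof.
have mapE s : [seq residue hr p | p <- s] =
    [seq phi x | x <- [seq Zeval a p | p <- s]].
  by rewrite -map_comp; apply: eq_map => p; rewrite /= phiE.
have [g _ phiK] := phi_bij.
split=> -[s -> eJ]; exists s => //.
  by rewrite (generated_preim phi_bij) -mapE -eJ.
(* Equal preimages under the surjective [phi] come from equal ideals. *)
move: eJ; rewrite (generated_preim phi_bij) -mapE => eJ; apply/seteqP.
by split=> x; rewrite -[x]phiK;
  have := congr1 (fun S => S (g x)) eJ; rewrite /preimage /= => ->.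
Qed.

Lemma phi_neq0 alpha : alpha <> 0 -> phi alpha <> 0.
Proof. by move=> alpha0; rewrite -(rmorph0 phi) => /(bij_inj phi_bij). Qed.

Local Notation upper := (maxsub_le_norm card_N le_mo le_basis Va phiE).
Local Notation lower := (norm_le_maxsub card_N le_mo le_basis Va phiE).

Lemma maxsub_gt0 (alpha : Zadj a) : alpha <> 0 -> 0 < maxsub I alpha.
Proof.
move=> /phi_neq0 /(norm_gt0 le_basis) norm0; rewrite ltNge; apply/negP => max0.
have : (norm le (phi alpha))%:R <= 0 :> R.
  by apply: le_trans (lower alpha) _; rewrite mulr_ge0_le0.
by rewrite -(ler_nat R 1) in norm0; move/(le_trans norm0); rewrite ler10.
Qed.

Lemma SSub_solves_SPP J v :
  solves (SSub I a gamma) (preim_ideal phi J) v ->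
  solves (SPP hr le (gamma * N%:R ^+ 2)) J v.
Proof.
move=> [p [-> Jp p0 p_min]]; exists p.
(* Comparing the solution with itself gives [maxsub <= gamma * maxsub] with a positive [maxsub]. *)
have gamma0 : 0 <= gamma.
  have max0 := maxsub_gt0 p0.
  by rewrite -(pmulr_lge0 _ max0) (le_trans (ltW max0)) // p_min.
have g0 : residue hr p <> 0 by rewrite -phiE; exact: phi_neq0.
have Jg : ideal_set J (residue hr p) by rewrite -phiE.
(* Chains [lower], the minimality of [p] and [upper]; each of the two bounds costs a factor [N]. *)
have le_norm g : ideal_set J g -> g <> 0 ->
    (norm le (residue hr p))%:R <= gamma * N%:R ^+ 2 * (norm le g)%:R.
  have [psi _ phiK] := phi_bij; rewrite -[g]phiK => Jx x0.
  rewrite -phiE (le_trans (lower _)) //.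
  have px0 : psi g <> 0 by move=> e; apply: x0; rewrite e rmorph0.
  have -> : gamma * N%:R ^+ 2 * (norm le (phi (psi g)))%:R =
      N%:R * (gamma * (N%:R * (norm le (phi (psi g)))%:R)) by ring.
  rewrite ler_wpM2l // (le_trans (p_min _ Jx px0)) // ler_wpM2l //.
  exact: upper.
split=> //.
have norm0 : 0 < (norm le (residue hr p))%:R :> R.
  by rewrite ltr0n; exact: norm_gt0.
(* Strict positivity, from [le_norm] at the solution itself, allows division by the factor before
   passing to the infimum. *)
have C0 : 0 < gamma * N%:R ^+ 2.
  rewrite -(pmulr_lgt0 _ norm0); exact: lt_le_trans norm0 (le_norm _ Jg g0).
rewrite -ler_pdivrMl //; apply: le_lambda1 => //.
  by exists (residue hr p).
by move=> g Jh h0; rewrite ler_pdivrMl //; exact: le_norm.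
Qed.

Lemma SPP_solves_SSub J v :
  solves (SPP hr le gamma) J v ->
  solves (SSub I a (gamma * N%:R ^+ 2)) (preim_ideal phi J) v.
Proof.
move=> [p [-> Jg g0 p_min]]; exists p.
have p0 : Zeval a p <> 0 by move=> e; apply: g0; rewrite -phiE e rmorph0.
split=> //; first by rewrite /= /preimage /= phiE.
move=> alpha Jalpha alpha0.
have lambda0 : 0 <= lambda1 le R J.
  by apply: le_lambda1 => //; exists (residue hr p).
(* A negative [gamma] would force the positive norm of the solution to be at most 0. *)
have gamma0 : 0 <= gamma.
  rewrite leNgt; apply/negP => gamma_lt0.
  have := le_trans p_min (mulr_le0_ge0 (ltW gamma_lt0) lambda0).
  by rewrite (ler_nat R _ 0) leqNgt norm_gt0.
rewrite (le_trans (upper _)) // phiE.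
have -> : gamma * N%:R ^+ 2 * maxsub I alpha =
  N%:R * (gamma * (N%:R * maxsub I alpha)) by ring.
rewrite ler_wpM2l // (le_trans p_min) // ler_wpM2l //.
apply: le_trans (lambda1_le_norm R le_mo le_basis Jalpha _) (lower _).
exact: phi_neq0.
Qed.

End Reductions.

(** The instance is passed on by the identity; as its code is free of [Hash], erasing through the
    first [Hash] leaves exactly the solution. *)
Lemma reducible_after_hash (K X Y : Type) (P : search_problem X) (x : K -> X)
    (Q : search_problem Y) (y : K -> Y) :
  (forall k w, codes P w (x k) -> all not_hash w /\ codes Q w (y k)) ->
  (forall k v, solves Q (y k) v -> solves P (x k) v) ->
  poly_reducible P x Q y.
Proof.
move=> PQ QP; exists id, after_hash.
split; [exact: polytime_id | exact: polytime_after_hash | |].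
  by move=> k w /PQ [].
by move=> k w v /PQ [wN _] /QP; rewrite after_hash_cat.
Qed.

Theorem theorem6p10 (R : realType) (n : nat) (r : 'I_n -> nat)
    (hr : forall i, (2 <= r i)%N) :
  free_fin_gen (cyc_ring hr) /\
  forall (N : nat) (le : rel 'X_{1..n}) (gamma : R)
    (psi : forall a : 'I_n -> R[i], zeros (cyc_ideal hr) a ->
       {rmorphism Zadj a -> cyc_ring hr}),
  card_eq (@zeros R n (cyc_ideal hr)) `I_N ->
  monomial_order le ->
  monomial_basis hr le ->
  (forall a (Va : zeros (cyc_ideal hr) a) (p : {mpoly int[n]}),
     psi a Va (Zeval a p) = residue hr p) ->
  (forall a (Va : zeros (cyc_ideal hr) a), bijective (psi a Va)) ->
  forall (a : 'I_n -> R[i]) (Va : zeros (cyc_ideal hr) a),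
    poly_reducible (SPP hr le (gamma * N%:R ^+ 2)) id
                   (SSub (cyc_ideal hr) a gamma) (preim_ideal (psi a Va)) /\
    poly_reducible (SSub (cyc_ideal hr) a (gamma * N%:R ^+ 2))
                   (preim_ideal (psi a Va))
                   (SPP hr le gamma) id.
Proof.
split; first exact: cyc_ring_free R _ _ hr.
move=> N le gamma psi cN le_mo le_basis psiE psi_bij a Va.
have codesE := codes_transport le (psiE a Va) (psi_bij a Va).
split; apply: reducible_after_hash => J w.
- move=> cw; split; last exact: (iffLR (codesE _ _ _ _) cw).
  by case: cw => s -> _; exact: code_polys_not_hash.
- exact: SSub_solves_SPP.
- move=> cw; split; last exact: (iffRL (codesE _ _ _ _) cw).
  by case: cw => s -> _; exact: code_polys_not_hash.
- exact: SPP_solves_SSub.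
Qed.
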